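(* Let $\mathfrak{F}$ be an $N_0$-closed formation. (1) If $\mathfrak{F}$ is saturated and $\mathrm{F}(G)\subseteq G_\mathfrak{F}\subseteq\tilde{\mathrm{F}}(G)$ for every finite group $G$, then $\mathfrak{F}=\mathfrak{N}$ is the formation of all nilpotent groups. (2) If $\mathrm{F}^*(G)\subseteq G_\mathfrak{F}\subseteq\tilde{\mathrm{F}}(G)$ for every finite group $G$, then $\mathfrak{F}=\mathfrak{N}^*$ is the formation of all quasinilpotent groups.
   Context: All groups are finite. A formation is a class closed under homomorphic images such that $G/M,G/N\in\mathfrak{F}$ implies $G/(M\cap N)\in\mathfrak{F}$; it is saturated if $G/\Phi(G)\in\mathfrak{F}$ implies $G\in\mathfrak{F}$; it is $N_0$-closed if $G=NM$ with $N,M$ normal $\mathfrak{F}$-subgroups implies $G\in\mathfrak{F}$. $G_\mathfrak{F}$ is the largest normal $\mathfrak{F}$-subgroup of $G$. $\mathrm{F}(G)$ is the Fitting subgroup, $\mathrm{F}^*(G)$ the generalized Fitting subgroup, and $\tilde{\mathrm{F}}(G)$ is defined by $\Phi(G)\subseteq\tilde{\mathrm{F}}(G)$, $\tilde{\mathrm{F}}(G)/\Phi(G)=\mathrm{Soc}(G/\Phi(G))$. *)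

(* Defs.v *)
From mathcomp Require Import all_boot all_fingroup all_solvable.
Set Implicit Arguments. Unset Strict Implicit. Unset Printing Implicit Defensive.
Import GroupScope.

Definition gclass := forall gT : finGroupType, {group gT} -> Prop.

Definition formation (F : gclass) : Prop :=
  (forall (gT rT : finGroupType) (G : {group gT}) (f : {morphism G >-> rT}),
      F gT G -> F rT (f @* G)%G) /\
  (forall (gT : finGroupType) (G M N : {group gT}),
      M <| G -> N <| G -> F _ (G / M)%G -> F _ (G / N)%G ->
      F _ (G / (M :&: N))%G).

Definition saturated (F : gclass) : Prop :=
  forall (gT : finGroupType) (G : {group gT}), F _ (G / 'Phi(G))%G -> F gT G.

Definition N0_closed (F : gclass) : Prop :=
  forall (gT : finGroupType) (G M N : {group gT}),
    N <| G -> M <| G -> N * M = G :> {set gT} -> F gT N -> F gT M -> F gT G.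

Definition F_radical (F : gclass) (gT : finGroupType) (G R : {group gT}) : Prop :=
  R <| G /\ F gT R /\ (forall N : {group gT}, N <| G -> F gT N -> N \subset R).

Definition quasisimple (gT : finGroupType) (H : {group gT}) : bool :=
  ([~: H, H] == H) && simple (H / 'Z(H)).

Definition layer (gT : finGroupType) (G : {set gT}) : {set gT} :=
  << \bigcup_(H : {group gT} | (H <|<| G) && quasisimple H) H >>.

Definition Fstar (gT : finGroupType) (G : {group gT}) : {set gT} :=
  'F(G) <*> layer G.

Definition quasinilpotent (gT : finGroupType) (G : {group gT}) : bool :=
  Fstar G == G.

Definition socle (gT : finGroupType) (G : {set gT}) : {set gT} :=
  << \bigcup_(N : {group gT} | (N \subset G) && minnormal N G) N >>.

Definition Ftilde (gT : finGroupType) (G : {group gT}) : {set gT} :=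
  coset 'Phi(G) @*^-1 socle (G / 'Phi(G)).

(* Main.v *)
(** Every [G] in the formation satisfies [G = Ftilde G], i.e. [G / Phi(G)] is a
product of minimal normal subgroups, so [[V, G]] lies in [Phi(G)] for every
abelian normal [V].  Apply this to the fibre product [P] of [G] with itself over
[G / V] when [[V, G] = V]: then [V x 1] lies in [Phi(P)], although the diagonal
supplements it, so [V = 1].  Hence the Fitting subgroup of [G] is contained in
some term of the upper central series, and lifting the minimal normal subgroups
of [G / Phi(G)] shows that [G] is quasinilpotent.

If moreover the formation is saturated, [Q = G / F(G)] is perfect; suppose it has
an element [x] of order [r > 1].  There is an extension of [Q] in which every lift
of [x] has large order.  A minimal supplement [U] of its kernel [K] has
[U :&: K] inside [Phi(U)], hence lies in the formation, is perfect, and so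
[U :&: K] is central.  The transfer bounds the exponent of [U :&: K] by [#|Q|],
which contradicts the order of the lifts of [x].  *)

Require Import Defs.
From mathcomp Require Import all_boot all_fingroup all_solvable.
From mathcomp Require Import ssralg zmodp.
Set Implicit Arguments. Unset Strict Implicit. Unset Printing Implicit Defensive.
Import GroupScope.

(** * Frattini subgroups, formations and the upper central series *)

(** By the Frattini argument ['N_G(P)] supplements ['Phi(G)] for each Sylow subgroup [P] of
    ['Phi(G)], hence is all of [G]; so [P] is normal and lies in the Fitting subgroup. *)
Lemma Phi_nilpotent (gT : finGroupType) (G : {group gT}) : nilpotent 'Phi(G).
Proof.
suffices defPhi: 'F('Phi(G)) = 'Phi(G) by rewrite -defPhi Fitting_nil.
apply/eqP; rewrite eqEcard Fitting_sub dvdn_leq ?cardG_gt0 //.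
apply/dvdn_partP=> [|p _]; first exact: cardG_gt0.
have [P sylP] := Sylow_exists p 'Phi(G)%G.
rewrite -(card_Hall sylP) cardSg // Fitting_max ?(pgroup_nil (pHall_pgroup sylP)) //.
have sPPhi := pHall_sub sylP; rewrite /normal sPPhi.
have defG := Frattini_arg (Phi_normal G) sylP.
have : <<'N_G(P)>> = G.
  apply: Phi_nongen; apply/eqP; rewrite eqEsubset join_subG Phi_sub subsetIl /=.
  by rewrite -{1}defG mulG_subG joing_subl joing_subr.
rewrite genGid => NGP; apply: subset_trans (Phi_sub G) _.
by rewrite -{1}NGP subsetIr.
Qed.

Lemma formation_isog (F : gclass) (gT rT : finGroupType)
  (G : {group gT}) (H : {group rT}) : formation F -> G \isog H -> F gT G -> F rT H.
Proof.
move=> [Fmor _] /isogP[f _ defH] /(Fmor _ _ _ f).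
by congr (F _ _); apply/val_inj.
Qed.

Lemma formation_quotient (F : gclass) (gT : finGroupType) (G N : {group gT}) :
  formation F -> N <| G -> F gT G -> F _ (G / N)%G.
Proof.
(* Closure under images asks for a morphism with domain exactly [G], so [coset N] is restricted to
   [G]. *)
move=> [Fmor _] nsNG /(Fmor _ _ _ (restrm_morphism (normal_norm nsNG) (coset_morphism N))).
by congr (F _ _); apply/val_inj; rewrite /= morphim_restrm setIid.
Qed.

(** Induction on [n] with the three subgroups lemma: [[~: 'Z_n.+1(G), L]] lies in ['Z_n(G)], which
    [L] centralises, so [[~: L, L] = L] centralises ['Z_n.+1(G)]. *)
Lemma perfect_cent_ucn (gT : finGroupType) (G L : {group gT}) n :
  L \subset G -> [~: L, L] = L -> L \subset 'C('Z_n(G)).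
Proof.
move=> sLG perfL; elim: n => [|n IHn]; first by rewrite ucn0 cents1.
have cZL: [~: 'Z_n.+1(G), L] \subset 'Z_n(G).
  exact: subset_trans (commgS _ sLG) (ucn_comm n G).
have ZLL: [~: 'Z_n.+1(G), L, L] = 1.
  by apply/commG1P; rewrite centsC (subset_trans IHn) ?centS.
rewrite -perfL; apply/commG1P.
apply: (three_subgroup (H := 'Z_n.+1(G)%G)) => //.
by rewrite (commGC L).
Qed.

(** * Groups generated by their minimal normal subgroups modulo the Frattini subgroup *)

Definition Phi_semisimple (gT : finGroupType) (G : {group gT}) : bool :=
  G / 'Phi(G) \subset socle (G / 'Phi(G)).

Lemma Phi_semisimple_Ftilde (gT : finGroupType) (G : {group gT}) :
  G \subset Ftilde G -> Phi_semisimple G.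
Proof.
by move=> sGF; rewrite /Phi_semisimple sub_quotient_pre ?(normal_norm (Phi_normal G)).
Qed.

(** A minimal normal subgroup either meets [V] trivially, so commutes with it, or lies in the
    abelian group [V]. *)
Lemma socle_cent_abelian_normal (gT : finGroupType) (G V : {group gT}) :
  G \subset socle G -> V <| G -> abelian V -> G \subset 'C(V).
Proof.
move=> sGS nsVG abV; apply: subset_trans sGS _; rewrite gen_subG.
apply/bigcupsP=> N /andP[sNG /mingroupP[/andP[_ nNG] minN]].
have [tiNV | ntNV] := eqVneq (N :&: V) 1.
  apply/commG1P/trivgP; rewrite -tiNV subsetI commg_subl commg_subr.
  by rewrite (subset_trans sNG (normal_norm nsVG)) (subset_trans (normal_sub nsVG)).
have defN : N :&: V = N.
  by apply: minN; rewrite ?subsetIl // ntNV normsI // normal_norm.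
by rewrite -defN (subset_trans (subsetIr _ _)) // -abelianE.
Qed.

Lemma Phi_semisimple_comm (gT : finGroupType) (G V : {group gT}) :
  Phi_semisimple G -> V <| G -> abelian V -> [~: V, G] \subset 'Phi(G).
Proof.
move=> ssG nsVG abV; have nPhi := normal_norm (Phi_normal G).
rewrite -quotient_cents2 ?(subset_trans (normal_sub nsVG)) // centsC.
by rewrite socle_cent_abelian_normal ?quotient_normal ?quotient_abelian.
Qed.

(** Each minimal normal [M] centralises [N] or lies in it, so it normalises every normal subgroup
    [K] of [N]. Such a [K] is then normalised by [G], and minimality of [N] applies. *)
Lemma socle_minnormal_simple (gT : finGroupType) (G N : {group gT}) :
    G \subset socle G -> minnormal N G -> N \subset G -> ~~ abelian N ->
  [~: N, N] = N /\ simple N.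
Proof.
move=> sGS minNG sNG nabN; have [/andP[ntN nNG] minN] := mingroupP minNG.
split.
  apply: minN; rewrite ?commg_subl ?normG // normsR // andbT.
  by apply: contraNneq nabN => /commG1P; rewrite -abelianE.
apply/mingroupP; rewrite ntN normG; split=> // K /andP[ntK nKN] sKN.
apply: minN; rewrite // ntK; apply: subset_trans sGS _; rewrite gen_subG.
apply/bigcupsP=> M /andP[sMG /mingroupP[/andP[ntM nMG] minM]].
have [tiMN | ntMN] := eqVneq (M :&: N) 1.
  rewrite (subset_trans _ (cent_sub K)) // (subset_trans _ (centS sKN)) //.
  apply/commG1P/trivgP; rewrite -tiMN subsetI commg_subl commg_subr.
  by rewrite (subset_trans sMG nNG) (subset_trans sNG nMG).
have defM : M :&: N = M by apply: minM; rewrite ?subsetIl // ntMN normsI.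
by apply: subset_trans nKN; rewrite -defM subsetIr.
Qed.

Lemma formation_subdirect (F : gclass) (gT : finGroupType) (G M N : {group gT}) :
  formation F -> M <| G -> N <| G -> M :&: N = 1 ->
  F _ (G / M)%G -> F _ (G / N)%G -> F gT G.
Proof.
move=> formF nsMG nsNG tiMN FGM FGN.
have FG1 := formF.2 _ _ _ _ nsMG nsNG FGM FGN.
apply: formation_isog formF _ FG1.
by rewrite isog_sym /= tiMN quotient1_isog.
Qed.

(** * Fibre products and abelian normal subgroups *)

Section FibreProduct.

Variables (gT : finGroupType) (G V : {group gT}).
Hypothesis nsVG : V <| G.

Definition fibre_product := [set u in setX G G | coset V u.1 == coset V u.2].

Fact fibre_product_group_set : group_set fibre_product.
Proof.
have nVG := subsetP (normal_norm nsVG).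
apply/group_setP; split=> [|u v]; rewrite !inE /=.
  by rewrite !group1 eqxx.
case/andP=> /andP[Gu1 Gu2] /eqP eq_u /andP[/andP[Gv1 Gv2] /eqP eq_v].
by rewrite !groupM //= !(morphM (coset_morphism V)) ?nVG //= eq_u eq_v.
Qed.

Canonical fibre_product_group := Group fibre_product_group_set.

(** Both projections map onto [G], because the diagonal does, and their kernels meet trivially. *)
Lemma formation_fibre_product (F : gclass) :
  formation F -> F gT G -> F _ fibre_product_group.
Proof.
move=> formF FG; pose P := fibre_product_group.
have sub_diag g : g \in G -> (g, g) \in P by move=> Gg; rewrite !inE /= Gg eqxx.
have fstP : @fst gT gT @* P = G.
  apply/setP=> g; apply/morphimP/idP=> [[[a b] _ /setIdP[/setXP[Ga _] _] ->] //|Gg].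
  by exists (g, g) => //; apply: sub_diag.
have sndP : @snd gT gT @* P = G.
  apply/setP=> g; apply/morphimP/idP=> [[[a b] _ /setIdP[/setXP[_ Gb] _] ->] //|Gg].
  by exists (g, g) => //; apply: sub_diag.
apply: (@formation_subdirect _ _ _ ('ker_P (@fst gT gT)) ('ker_P (@snd gT gT))) => //.
- exact: normalGI (subsetT _) (ker_normal _).
- exact: normalGI (subsetT _) (ker_normal _).
- apply/trivgP/subsetP=> -[a b]; rewrite !inE /= => /and3P[/andP[_ a1] _ b1].
  by rewrite xpair_eqE a1 b1.
- have iso : G \isog P / 'ker_P (@fst gT gT).
    by rewrite isog_sym -[X in _ \isog X]fstP first_isog_loc ?subsetT.
  exact: formation_isog formF iso FG.
have iso : G \isog P / 'ker_P (@snd gT gT).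
  by rewrite isog_sym -[X in _ \isog X]sndP first_isog_loc ?subsetT.
exact: formation_isog formF iso FG.
Qed.

End FibreProduct.

Lemma formation_abelian_comm_eq1 (F : gclass) (gT : finGroupType) (G V : {group gT}) :
    formation F -> (forall rT (H : {group rT}), F rT H -> Phi_semisimple H) ->
  F gT G -> V <| G -> abelian V -> [~: V, G] = V -> V :=: 1.
Proof.
move=> formF ssF FG nsVG abV VG; pose P := fibre_product_group nsVG.
have FP : F _ P by apply: formation_fibre_product.
have diagP g : g \in G -> (g, g) \in P by move=> Gg; rewrite !inE /= Gg eqxx.
have sVG := subsetP (normal_sub nsVG).
have gD : group_set [set u : gT * gT | u.1 == u.2].
  apply/group_setP; split=> [|u v]; rewrite !inE //=.
  by move=> /eqP-> /eqP->.
pose D := (P :&: Group gD)%G.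
pose W := (pairg1 gT @* V)%G.
have sWP : W \subset P.
  apply/subsetP=> _ /morphimP[v _ Vv ->]; rewrite !inE /= group1 sVG //=.
  by rewrite morph1 coset_id.
have nsWP : W <| P.
  rewrite /normal sWP; apply/subsetP=> -[a b] /setIdP[/setXP[/= Ga _] _].
  rewrite inE; apply/subsetP=> _ /imsetP[_ /morphimP[v _ Vv ->] ->].
  apply/morphimP; exists (v ^ a); rewrite ?inE ?memJ_norm //.
    by apply: subsetP Ga; apply: normal_norm.
  by rewrite /pairg1; congr pair; rewrite /= ?mul1g ?mulVg.
have sWPhi : W \subset 'Phi(P).
  apply: subset_trans (Phi_semisimple_comm (ssF _ _ FP) nsWP _); last first.
    by rewrite morphim_abelian.
  (* [W = [~: W, P]] would follow from [V = [~: V, G]]; the inclusion needed comes from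
     [[~ (v, 1), (g, g)] = ([~ v, g], 1)]. *)
  rewrite /= -{1}VG morphim_gen ?subsetT // genS //.
  apply/subsetP=> _ /morphimP[_ _ /imset2P[v g Vv Gg ->] ->].
  apply/imset2P; exists (pairg1 gT v) (g, g); rewrite ?diagP ?mem_morphim ?inE //.
  by congr pair; rewrite /= ?mul1g ?mulVg // commgEl conj1g mulg1 invg1.
have defP : 'Phi(P) <*> D = P.
  apply/eqP; rewrite eqEsubset join_subG Phi_sub subsetIl /=.
  apply: (@subset_trans _ _ (W * D)); last first.
    by rewrite mul_subG ?joing_subr // (subset_trans sWPhi) ?joing_subl.
  (* [(a, b) = (a * b^-1, 1) * (b, b)], where [a * b^-1] lies in [V]. *)
  apply/subsetP=> -[a b] /setIdP[/setXP[/= Ga Gb] /eqP eq_ab].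
  apply/mulsgP; exists (pairg1 gT (a * b^-1)) (b, b); last 1 first.
  - by congr pair; rewrite /= ?mulgKV ?mul1g.
  - rewrite mem_morphim ?inE //.
    have nVG := subsetP (normal_norm nsVG).
    rewrite coset_idr ?groupM ?nVG ?groupV //.
    by rewrite morphM ?morphV ?nVG ?groupV //= eq_ab mulgV.
  by apply/setIP; split; [apply: diagP | rewrite inE].
have {}defP : D :=: P by rewrite -(Phi_nongen defP) genGid.
apply/trivgP/subsetP=> v Vv.
have : pairg1 gT v \in D by rewrite defP (subsetP sWP) // mem_morphim ?inE.
by rewrite inE => /andP[_]; rewrite inE /= => /eqP->; rewrite inE.
Qed.

(** Induction on the order of [V]: if [[~: V, G]] is proper in [V] it is trivial by induction, so
    [V] is central. *)
Lemma formation_abelian_normal_eq1 (F : gclass) (gT : finGroupType) (G V : {group gT}) :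
    formation F -> (forall rT (H : {group rT}), F rT H -> Phi_semisimple H) ->
  F gT G -> 'Z(G) = 1 -> V <| G -> abelian V -> V :=: 1.
Proof.
move=> formF ssF FG ZG1; have [n] := ubnP #|V|; elim: n V => // n IHn V ltVn nsVG abV.
have [|neqV] := eqVneq [~: V, G] V.
  exact: formation_abelian_comm_eq1 formF ssF FG nsVG abV.
have sRV : [~: V, G] \subset V by rewrite commg_subl normal_norm.
have R1 : [~: V, G] = 1.
  apply: (IHn [~: V, G]%G); last exact: abelianS abV.
    by rewrite (leq_trans _ (ltnSE ltVn)) // proper_card // properEneq neqV.
  by rewrite /normal (subset_trans sRV (normal_sub nsVG)) normsR ?normG ?normal_norm.
apply/trivgP; rewrite -ZG1 subsetI normal_sub //=; exact/commG1P.
Qed.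

(** * The Fitting subgroup is hypercentral *)

Lemma ucn_stable (gT : finGroupType) (G : {group gT}) :
  exists n, 'Z(G / 'Z_n(G)) = 1.
Proof.
suffices [n eqZ] : exists n, 'Z_n.+1(G) = 'Z_n(G).
  by exists n; rewrite -ucn_central eqZ trivg_quotient.
suffices stable k n : #|G| - #|'Z_n(G)| < k -> exists m, 'Z_m.+1(G) = 'Z_m(G).
  exact: (stable _ 0 (ltnSn _)).
elim: k n => // k IHk n ltk; have [|neqZ] := eqVneq 'Z_n.+1(G) 'Z_n(G); first by exists n.
have ltZ : #|'Z_n(G)| < #|'Z_n.+1(G)|.
  by rewrite proper_card // properEneq eq_sym neqZ ucn_subS.
apply: (IHk n.+1); apply: leq_trans (ltnSE ltk); apply: ltn_sub2l => //.
exact: leq_trans ltZ (subset_leq_card (ucn_sub _ _)).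
Qed.

(** Once the upper central series is stationary, the quotient has trivial centre. There the image of
    ['F(G)] is nilpotent with an abelian normal centre, which is trivial, so the image is
    trivial. *)
Lemma formation_Fitting_ucn (F : gclass) (gT : finGroupType) (G : {group gT}) :
    formation F -> (forall rT (H : {group rT}), F rT H -> Phi_semisimple H) ->
  F gT G -> exists n, 'F(G) \subset 'Z_n(G).
Proof.
move=> formF ssF FG; have [n ZG1] := ucn_stable G; exists n.
have nsZG := ucn_normal n G.
have nsFG : 'F(G) / 'Z_n(G) <| G / 'Z_n(G) by rewrite quotient_normal ?Fitting_normal.
have nilF : nilpotent ('F(G) / 'Z_n(G)) by rewrite quotient_nil ?Fitting_nil.
have nFZ : 'F(G) \subset 'N('Z_n(G)).
  exact: subset_trans (Fitting_sub G) (normal_norm nsZG).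
rewrite -quotient_sub1 // subG1 -center_nil_eq1 //.
apply/eqP/(@formation_abelian_normal_eq1 F _ (G / 'Z_n(G))%G) => //.
- exact: formation_quotient.
- exact: gFnormal_trans.
exact: center_abelian.
Qed.

(** * Lifting minimal normal subgroups of [G / 'Phi(G)] *)

Lemma layer_sub (gT : finGroupType) (G : {group gT}) : layer G \subset G.
Proof. by rewrite gen_subG; apply/bigcupsP=> H /andP[/subnormal_sub]. Qed.

(** [N] is central, so its preimage lies in ['Z_n.+1(G)] and is nilpotent. *)
Lemma abelian_normal_sub_Fitting (gT : finGroupType) (G : {group gT})
    (N : {group coset_of 'Phi(G)}) n :
    Phi_semisimple G -> 'Phi(G) \subset 'Z_n(G) ->
  N <| G / 'Phi(G) -> abelian N -> N \subset 'F(G) / 'Phi(G).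
Proof.
move=> ssG sPhiZ nsN abN; have cNG := socle_cent_abelian_normal ssG nsN abN.
have [M defN sPhiM nsMG] := inv_quotientN (Phi_normal G) nsN.
have nPhi := normal_norm (Phi_normal G); have sMG := normal_sub nsMG.
rewrite defN quotientS // Fitting_max //; apply: nilpotentS (ucn_nilpotent n.+1 G).
apply/subsetP=> x Mx; rewrite ucnSnR inE (subsetP sMG) //=.
apply: subset_trans sPhiZ; apply: subset_trans (commSg _ _) _; first by rewrite sub1set; exact: Mx.
by rewrite -quotient_cents2 ?(subset_trans sMG) // centsC -defN.
Qed.

(** Take [L] minimal among the normal subgroups of [G] covering [N]. As [N] is perfect, so is [L];
    hence ['Phi(G) :&: L] is central in [L], with simple quotient isomorphic to [N], and [L] is
    quasisimple. *)
Lemma minnormal_nonabelian_sub_layer (gT : finGroupType) (G : {group gT})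
    (N : {group coset_of 'Phi(G)}) n :
    Phi_semisimple G -> 'Phi(G) \subset 'Z_n(G) ->
    minnormal N (G / 'Phi(G)) -> N \subset G / 'Phi(G) -> ~~ abelian N ->
  N \subset layer G / 'Phi(G).
Proof.
move=> ssG sPhiZ minN sNG nabN.
have [perfN simN] := socle_minnormal_simple ssG minN sNG nabN.
have nsN : N <| G / 'Phi(G) by rewrite /normal sNG; case/mingroupP: minN => /andP[].
have [M defN sPhiM nsMG] := inv_quotientN (Phi_normal G) nsN.
have nPhi := normal_norm (Phi_normal G); have sMG := normal_sub nsMG.
have nPhiM := subset_trans sMG nPhi.
pose gP (L : {group gT}) := (L <| G) && (M \subset 'Phi(G) * L).
have gPM : gP M by rewrite /gP nsMG mulG_subr.
have [L /mingroupP[/andP[nsLG sML] minL] sLM] := mingroup_exists gPM.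
have nPhiL : L \subset 'N('Phi(G)) := subset_trans (normal_sub nsLG) nPhi.
have defNL : N :=: L / 'Phi(G).
  apply/eqP; rewrite defN eqEsubset (quotientS _ sLM) andbT.
  by rewrite quotientSK.
have perfL : [~: L, L] = L.
  apply: (minL [~: L, L]%G); rewrite ?commg_subl ?normG // /gP.
  rewrite -quotientSK // quotientR // -defN -defNL perfN subxx andbT.
  by rewrite /normal normsR ?normal_norm // (subset_trans _ (normal_sub nsLG)) ?commg_subl ?normG.
have sIZ : 'Phi(G) :&: L \subset 'Z(L).
  rewrite subsetI subsetIr (subset_trans (subsetIl _ _)) // (subset_trans sPhiZ) //.
  by rewrite centsC perfect_cent_ucn // normal_sub.
have simLI : simple (L / ('Phi(G) :&: L)).
  by rewrite (isog_simple (second_isog nPhiL)); move: simN; rewrite defNL.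
have nIL : L \subset 'N('Phi(G) :&: L) by rewrite normsI ?normG.
have quasiL : quasisimple L.
  rewrite /quasisimple perfL eqxx /=.
  have [ntLI simL] := simpleP _ simLI.
  have : 'Z(L) / ('Phi(G) :&: L) <| L / ('Phi(G) :&: L).
    exact: quotient_normal (center_normal L).
  case/simL => eqZ.
    have /eqP := eqZ; rewrite -subG1 quotient_sub1 ?(subset_trans (center_sub L) nIL) // => sZI.
    suffices -> : 'Z(L) = 'Phi(G) :&: L by [].
    by apply/eqP; rewrite eqEsubset sZI.
  have /eqP := eqZ; rewrite eq_sym eqEsubset => /andP[].
  rewrite quotientSGK // subsetI subxx /= -abelianE => abL _.
  case/negP: ntLI; rewrite -subG1 quotient_sub1 //.
  have L1 : L :=: 1 by rewrite -perfL; apply/commG1P.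
  by rewrite {1}L1 sub1G.
rewrite defNL quotientS // sub_gen //.
by apply: (bigcup_sup L); rewrite // quasiL andbT normal_subnormal.
Qed.

Section SemisimpleFormation.

Variable F : gclass.
Hypotheses (formF : formation F)
  (ssF : forall gT (G : {group gT}), F G -> Phi_semisimple G).
Variables (gT : finGroupType) (G : {group gT}).
Hypothesis FG : F G.

Lemma formation_quasinilpotent : quasinilpotent G.
Proof.
have ssG := ssF FG; have [n sFZ] := formation_Fitting_ucn formF ssF FG.
have sPhiF : 'Phi(G) \subset 'F(G) by rewrite Fitting_max ?Phi_normal ?Phi_nilpotent.
have sPhiZ := subset_trans sPhiF sFZ.
rewrite /quasinilpotent eqEsubset join_subG Fitting_sub layer_sub /=.
rewrite -(@quotientSGK _ 'Phi(G)%G G) ?normal_norm ?Phi_normal //; last first.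
  exact: subset_trans sPhiF (joing_subl _ _).
apply: (subset_trans ssG _); rewrite gen_subG; apply/bigcupsP=> N /andP[sNG minN].
have [abN | nabN] := boolP (abelian N).
  apply: subset_trans (quotientS _ (joing_subl _ _)).
  apply: abelian_normal_sub_Fitting sPhiZ _ abN => //.
  by apply/andP; split=> //; case/mingroupP: minN => /andP[].
apply: subset_trans (quotientS _ (joing_subr _ _)).
exact: minnormal_nonabelian_sub_layer sPhiZ minN sNG nabN.
Qed.

(** Modulo ['Phi(G)], abelian minimal normal subgroups lie in the image of ['F(G)] and nonabelian
    ones, being perfect, in that of [[~: G, G]]. *)
Lemma formation_quotient_Fitting_perfect :
  [~: G / 'F(G), G / 'F(G)] = G / 'F(G).
Proof.
have ssG := ssF FG; have [n sFZ] := formation_Fitting_ucn formF ssF FG.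
have sPhiF : 'Phi(G) \subset 'F(G) by rewrite Fitting_max ?Phi_normal ?Phi_nilpotent.
have sPhiZ := subset_trans sPhiF sFZ; have nPhi := normal_norm (Phi_normal G).
have nFG := normal_norm (Fitting_normal G).
apply/eqP; rewrite eqEsubset commg_subl normG /= -quotientR //.
rewrite quotientSK // -norm_joinEr; last first.
  by rewrite (subset_trans _ nFG) ?commg_subl ?normG.
rewrite -(@quotientSGK _ 'Phi(G)%G G) //; last exact: subset_trans sPhiF (joing_subl _ _).
apply: (subset_trans ssG _); rewrite gen_subG; apply/bigcupsP=> N /andP[sNG minN].
have [abN | nabN] := boolP (abelian N).
  apply: subset_trans (quotientS _ (joing_subl _ _)).
  apply: abelian_normal_sub_Fitting sPhiZ _ abN => //.
  by apply/andP; split=> //; case/mingroupP: minN => /andP[].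
apply: subset_trans (quotientS _ (joing_subr _ _)).
have [<- _] := socle_minnormal_simple ssG minN sNG nabN.
by rewrite quotientR // commgSS.
Qed.

End SemisimpleFormation.

(** * The transfer, and a cover in which lifts have large order *)

(** The transfer from [G] to the abelian group [Z] kills [[~: G, G] = G]. A central [z] fixes every
    coset of [Z], so its transfer is [z ^+ #|G : Z|]. *)
Lemma perfect_central_expg_index (gT : finGroupType) (G Z : {group gT}) z :
  [~: G, G] = G -> Z \subset 'Z(G) -> z \in Z -> z ^+ #|G : Z| = 1.
Proof.
move=> perfG sZZ Zz; have [sZG cGZ] := subsetIP sZZ.
have abZ : abelian (idm Z @* Z).
  by rewrite morphim_idm // (abelianS sZZ) ?center_abelian.
pose V := transfer_morphism G abZ.
have V0 : V z = 1.
  apply/set1P; have : V z \in V @* G by rewrite mem_morphim // (subsetP sZG).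
  suffices VG1 : V @* [~: G, G] = 1 by rewrite perfG in VG1; rewrite VG1.
  rewrite morphimR //; apply/commG1P.
  by apply/subsetP=> u _; apply/centP=> v _; apply: GRing.addrC.
have /(congr1 FiniteModule.fmval) : FiniteModule.fmod abZ (z ^+ #|G : Z|) = V z.
  rewrite FiniteModule.fmodX ?morphim_idm //= /transfer.
  rewrite (eq_bigr (fun=> FiniteModule.fmod abZ z)) => [|_ /rcosetsP[x Gx ->]].
    by rewrite GRing.sumr_const.
  have Zxz : Z :* x :* z = Z :* x.
    by rewrite -rcosetM -(centsP cGZ z Zz x Gx) rcosetM (rcoset_id Zz).
  rewrite Zxz; case: repr_rcosetP => y Zy.
  have Gyx : y * x \in G by rewrite groupM // (subsetP sZG).
  by rewrite -(centsP cGZ z Zz _ Gyx) mulgK.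
  by rewrite morphim_idm.
have fmodK : FiniteModule.fmval (FiniteModule.fmod abZ (z ^+ #|G : Z|)) = z ^+ #|G : Z|.
  by apply: FiniteModule.fmodK; rewrite /= morphim_idm ?groupX.
by rewrite fmodK => ->; rewrite V0.
Qed.

(* The coinduced extension: [proj] maps [cover_space] onto [gT], and the shifts
by [#[x]] have the orbits that are its fibres.  A permutation in the group
[cover_set] commutes with the shifts and induces a right translation on [gT];
a lift of [x] acts on the shift-orbit over [<[x]>] as a shift by some
[j = 1 %[mod #[x]]], whence its large order. *)
Section CyclicCover.

Variables (gT : finGroupType) (x : gT) (q : nat).
Hypothesis m_gt1 : 1 < #[x] * q.

Local Notation m := (#[x] * q)%N.
Local Notation C := <[x]>.

(** Each right coset of [<[x]>] contains exactly one such element, so this type indexes the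
    cosets. *)
Local Notation coset_rep := {t : gT | repr (C :* t) == t}.

Fact repr_repr g : repr (C :* repr (C :* g)) == repr (C :* g).
Proof. by rewrite rcoset_repr. Qed.

Definition rep g : coset_rep := exist _ (repr (C :* g)) (repr_repr g).

Local Notation cover_space := (coset_rep * 'Z_m)%type.

Definition proj (w : cover_space) : gT := x ^+ w.2 * val w.1.

Definition shift (k : 'Z_m) (w : cover_space) : cover_space := (w.1, (w.2 + k)%R).

Fact expg_Zp_trunc : x ^+ (Zp_trunc m).+2 = 1.
Proof. by rewrite Zp_cast // expgM expg_order expg1n. Qed.

Lemma proj_shift k w : proj (shift k w) = x ^+ k * proj w.
Proof. by rewrite /proj mulgA -expgD addnC /= expg_mod // expg_Zp_trunc. Qed.

Definition cover_set : {set {perm cover_space}} :=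
  [set s : {perm cover_space} | [forall k, forall w, s (shift k w) == shift k (s w)]
     && [exists g, forall w, proj (s w) == proj w * g]].

Lemma cover_setP (s : {perm cover_space}) :
  reflect ((forall k w, s (shift k w) = shift k (s w)) /\
           exists g, forall w, proj (s w) = proj w * g) (s \in cover_set).
Proof.
rewrite inE; apply: (iffP andP) => -[].
  move=> /forallP sk /existsP[g /forallP sg].
  by split=> [k w|]; [exact/eqP/(forallP (sk k)) | exists g => w; exact/eqP].
move=> sk [g sg]; split; first by apply/forallP=> k; apply/forallP=> w; rewrite sk.
by apply/existsP; exists g; apply/forallP=> w; rewrite sg.
Qed.

Fact cover_group_set : group_set cover_set.
Proof.
apply/group_setP; split=> [|s t].
  by apply/cover_setP; split=> [k w|]; [rewrite !perm1 | exists 1 => w; rewrite perm1 mulg1].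
move=> /cover_setP[sk [g sg]] /cover_setP[tk [h th]]; apply/cover_setP.
split=> [k w|]; first by rewrite !permM sk tk.
by exists (g * h) => w; rewrite permM th sg mulgA.
Qed.

Canonical cover_group := Group cover_group_set.

Definition cover_base : cover_space := (rep 1, 0%R).

(** For [s] in [cover_set], this is the element whose right translation [s] induces, read off at one
    point. *)
Definition cover_map (s : {perm cover_space}) :=
  (proj cover_base)^-1 * proj (s cover_base).

Lemma cover_mapE s w : s \in cover_set -> proj (s w) = proj w * cover_map s.
Proof. by case/cover_setP=> _ [g sg]; rewrite /cover_map !sg mulKg. Qed.

Fact cover_mapM : {in cover_set &, {morph cover_map : s t / s * t}}.
Proof.
move=> s t Gs Gt; apply: (mulgI (proj cover_base)).
rewrite -cover_mapE ?(groupM (G := cover_group)) //.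
by rewrite permM !cover_mapE ?mulgA.
Qed.

Canonical cover_morphism := @Morphism _ _ cover_set cover_map cover_mapM.

(* The value is junk ([0]) outside [<[x]>]. *)
Definition cycle_log (c : gT) : nat := odflt ord0 [pick i : 'I_#[x].-1.+1 | x ^+ i == c].

Lemma cycle_logK c : c \in C -> x ^+ cycle_log c = c.
Proof.
rewrite /cycle_log; case: pickP => [i /eqP-> // | noi /cyclePmin[i lti def_c]].
rewrite -(prednK (order_gt0 x)) in lti.
by have /= := noi (Ordinal lti); rewrite -def_c eqxx.
Qed.

(** A lift of right translation by [g]: the power of [x] by which [c] differs from its coset
    representative becomes a shift of the second coordinate. *)
Definition lift_fun g (w : cover_space) : cover_space :=
  let c := val w.1 * g in (rep c, (w.2 + (cycle_log (c * (repr (C :* c))^-1))%:R)%R).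

Lemma lift_fun_inj g : injective (lift_fun g).
Proof.
move=> [t i] [s j] eq_w; have /= eq_rep := congr1 (fun w => val w.1) eq_w.
have /= := congr1 snd eq_w.
have defC u : C :* (val u * g) = C :* repr (C :* (val u * g)) by rewrite rcoset_repr.
have eqC : C :* val t = C :* val s.
  have rK u : C :* u = C :* (u * g) :* g^-1 by rewrite -rcosetM mulgK.
  by rewrite rK defC eq_rep -defC -rK.
have -> : t = s by apply: val_inj; rewrite -(eqP (valP t)) eqC (eqP (valP s)).
by move=> /GRing.addIr->.
Qed.

Lemma proj_lift g w : proj (lift_fun g w) = proj w * g.
Proof.
case: w => t i; rewrite /lift_fun /=; set c := val t * g; set k := cycle_log _.
rewrite -[(_, _)]/(shift k%:R%R (rep c, i)) proj_shift /proj /=.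
have -> : x ^+ (k%:R : 'Z_m)%R = c * (repr (C :* c))^-1.
  rewrite val_Zp_nat // expg_mod ?expgM ?expg_order ?expg1n //.
  apply: cycle_logK; rewrite -groupV invMg invgK -mem_rcoset; exact: mem_repr_rcoset.
have /centsP cCC := cycle_abelian x.
have Cc : c * (repr (C :* c))^-1 \in C.
  by rewrite -groupV invMg invgK -mem_rcoset mem_repr_rcoset.
by rewrite mulgA (cCC _ Cc _ (mem_cycle _ _)) -!mulgA mulVg mulg1.
Qed.

Lemma cover_map_surj : cover_map @* cover_set = setT.
Proof.
apply/setP=> g; rewrite inE; apply/morphimP.
pose s := perm (@lift_fun_inj g).
have proj_s w : proj (s w) = proj w * g by rewrite permE proj_lift.
have Gs : s \in cover_set.
  apply/cover_setP; split=> [k [t i]|]; last by exists g.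
  by rewrite !permE /lift_fun /shift /= GRing.addrAC.
exists s => //.
by rewrite -[RHS]/(cover_map s) /cover_map proj_s mulKg.
Qed.

(** [u] sends [(rep 1, 0)] to [(rep 1, j)] with [x ^+ j = x]. Commuting with shifts, [u ^+ n] sends
    it to [(rep 1, n * j)], so [n * j] vanishes in ['Z_m]. *)
Lemma cover_map_expg u n : u \in cover_set -> cover_map u = x -> u ^+ n = 1 ->
  exists2 j, j = 1 %[mod #[x]] & m %| n * j.
Proof.
move=> Gu fu un1; have /cover_setP[uk _] := Gu.
have /centsP cCC := cycle_abelian x.
have Crep : val (rep 1) \in C by rewrite /= rcoset1; apply: mem_repr (group1 _).
have := cover_mapE cover_base Gu; rewrite fu /proj /= expg0 mul1g.
case def_u1: (u cover_base) => [t j] /= eq_u1.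
have Ct : val t \in C.
  rewrite -(groupMl _ (mem_cycle x j)) eq_u1.
  by apply: groupM; [apply: Crep | apply: cycle_id].
have def_t : t = rep 1.
  by apply: val_inj; rewrite -(eqP (valP t)) (rcoset_id Ct) /= rcoset1.
have xj : x ^+ j = x ^+ 1.
  apply: (mulIg (val t)); rewrite eq_u1 expg1 def_t /=.
  by apply: cCC; rewrite ?cycle_id.
exists (val j); first by apply/eqP; rewrite -eq_expg_mod_order xj.
have uE k : (u ^+ k) cover_base = (rep 1, (k * j)%:R%R).
  elim: k => [|k IHk]; first by rewrite expg0 perm1.
  have -> : (u ^+ k.+1) cover_base = u (shift (k * j)%:R%R cover_base).
    by rewrite expgSr permM IHk /shift /= GRing.add0r.
  by rewrite uk def_u1 def_t /shift /= mulSn GRing.natrD natr_Zp.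
have /(congr1 snd)/(congr1 val) := uE n.
by rewrite un1 perm1 /= val_Zp_nat // => /esym/eqP.
Qed.

End CyclicCover.

(** * The saturated case and the conclusion *)

(** A maximal subgroup of [U] missing part of the kernel would supplement it in [U], hence have the
    same image as [U]. *)
Lemma minimal_supplement_ker_Phi (gT rT : finGroupType) (D U : {group gT})
    (f : {morphism D >-> rT}) :
    U \subset D -> (forall H : {group gT}, H \subset U -> f @* H = f @* U -> H :=: U) ->
  'ker_U f \subset 'Phi(U).
Proof.
move=> sUD minU; apply/bigcapsP=> M /orP[/eqP-> | maxM]; first exact: subsetIl.
have nsKU : 'ker_U f <| U by rewrite norm_normalI // (subset_trans sUD) ?ker_norm.
have [ltMU {}maxM] := maxgroupP maxM; have sMU := proper_sub ltMU.
have sKMU : 'ker_U f <*> M \subset U by rewrite join_subG subsetIl.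
have [defU | ltKMU] := eqVproper sKMU; last first.
  by rewrite -[gval M](maxM _ ltKMU) ?joing_subl ?joing_subr.
have : f @* M = f @* U.
  apply/eqP; rewrite eqEsubset morphimS //= morphimSK // -defU.
  by rewrite norm_joinEr ?mulSg ?subsetIr // (subset_trans _ (normal_norm nsKU)).
by move/minU => eqMU; rewrite eqMU // properxx in ltMU.
Qed.


Lemma saturated_formation_nilpotent (F : gclass) (gT : finGroupType) (G : {group gT}) :
    formation F -> saturated F ->
    (forall rT (H : {group rT}), F rT H -> Phi_semisimple H) ->
  F gT G -> nilpotent G.
Proof.
move=> formF satF ssF FG; pose Q := (G / 'F(G))%G.
have perfQ : [~: Q, Q] = Q by apply: formation_quotient_Fitting_perfect formF ssF _ _ FG.
have FQ : F _ Q by apply: formation_quotient; rewrite ?Fitting_normal.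
suffices Q1 : Q :=: 1.
  apply: nilpotentS (Fitting_nil G); rewrite -quotient_sub1 ?subG1 ?Q1 //.
  exact: normal_norm (Fitting_normal G).
apply/eqP/negPn/negP => /trivgPn[x Qx ntx].
(* The final divisibility forces [q] to divide [#|Q|], while [r ^ #|Q|] exceeds [#|Q|]. *)
pose r := #[x]; pose q := (r ^ #|Q|)%N.
have r_gt1 : 1 < r by rewrite order_gt1.
have q_gt0 : 0 < q by rewrite expn_gt0 order_gt0.
have m_gt1 : 1 < #[x] * q by rewrite (leq_trans r_gt1) // leq_pmulr.
pose f := cover_morphism x q; pose D := cover_group x q.
pose gP (U : {group _}) := (U \subset D) && (f @* U == Q).
have gP0 : gP (f @*^-1 Q)%G.
  rewrite /gP subsetIl morphpreK //= /f; have := cover_map_surj m_gt1.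
  by move=> /= ->; rewrite subsetT.
have [U /mingroupP[/andP[sUD /eqP fU] minU] _] := mingroup_exists gP0.
have {}minU (H : {group _}) : H \subset U -> f @* H = Q -> H :=: U.
  by move=> sHU fH; apply: minU => //; rewrite /gP (subset_trans sHU) //= fH.
have sKPhi : 'ker_U f \subset 'Phi(U).
  by apply: minimal_supplement_ker_Phi => // H sHU; rewrite fU; apply: minU.
have nsKU : 'ker_U f <| U by rewrite norm_normalI // (subset_trans sUD) ?ker_norm.
have isoQ : U / 'ker_U f \isog Q by rewrite /= -[in X in _ \isog X]fU first_isog_loc.
have FU : F _ U.
  (* [U / 'Phi(U)] is a quotient of [U / 'ker_U f], a copy of [Q]; saturation lifts membership to
     [U]. *)
  apply: (satF); apply: (formation_isog formF (third_isog sKPhi nsKU (Phi_normal U))).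
  apply: formation_quotient; rewrite ?quotient_normal ?Phi_normal //.
  by apply: (formation_isog formF _ FQ); rewrite isog_sym.
have perfU : [~: U, U] = U.
  apply: (minU [~: U, U]%G); first by rewrite commg_subl normG.
  by rewrite morphimR // fU perfQ.
have sKZ : 'ker_U f \subset 'Z(U).
  have [n sFZ] := formation_Fitting_ucn formF ssF FU.
  rewrite subsetI subsetIl (subset_trans sKPhi) //.
  apply: (subset_trans (Fitting_max (Phi_normal U) (Phi_nilpotent U))).
  by apply: (subset_trans sFZ); rewrite centsC perfect_cent_ucn.
have indexK : #|U : 'ker_U f| = #|Q|.
  by rewrite -card_quotient ?normal_norm // (card_isog isoQ).
have /morphimP[u Du Uu def_x] : x \in f @* U by rewrite fU.
have Kur : u ^+ r \in 'ker_U f.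
  have fur : f (u ^+ r) = 1 by rewrite (morphX f) // -def_x expg_order.
  by apply/setIP; split; [apply: groupX | apply/kerP => //; apply: groupX].
have := perfect_central_expg_index perfU sKZ Kur; rewrite indexK -expgM => u1.
have [j j1] := cover_map_expg m_gt1 Du (esym def_x) u1.
(* Cancelling [r] leaves [q] dividing [#|Q| * j], and [j], being 1 modulo [r], is coprime to [q]. *)
rewrite -mulnA dvdn_pmul2l ?order_gt0 // Gauss_dvdl; last first.
  by rewrite coprimeXl // coprime_sym -coprime_modl j1 coprime_modl coprime1n.
move/dvdn_leq => /(_ (cardG_gt0 Q)); rewrite leqNgt; case/negP.
exact: ltn_expl.
Qed.

Theorem theorem3 (F : gclass) :
  formation F -> N0_closed F ->
  (saturated F ->
   (forall (gT : finGroupType) (G : {group gT}), exists R : {group gT},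
      F_radical F G R /\ 'F(G) \subset R /\ R \subset Ftilde G) ->
   forall (gT : finGroupType) (G : {group gT}), F gT G <-> nilpotent G) /\
  ((forall (gT : finGroupType) (G : {group gT}), exists R : {group gT},
      F_radical F G R /\ Fstar G \subset R /\ R \subset Ftilde G) ->
   forall (gT : finGroupType) (G : {group gT}), F gT G <-> quasinilpotent G).
Proof.
move=> formF _; split.
  move=> satF radF gT G; split=> [|nilG].
    apply: saturated_formation_nilpotent => // {gT G} gT G FG.
    (* A group in [F] lies in its own radical, so the upper bound on [R] applies to [G] itself. *)
    have [R [[_ [_ maxR]] [_ sRF]]] := radF _ G.
    exact: Phi_semisimple_Ftilde (subset_trans (maxR G (normal_refl G) FG) sRF).
  have [R [[/normal_sub sRG [FR _]] [sFR _]]] := radF _ G.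
  rewrite (nilpotent_Fitting nilG) in sFR.
  suffices -> : G = R by [].
  by apply/val_inj/eqP; rewrite eqEsubset sFR sRG.
move=> radF gT G; split=> [|/eqP qnilG].
  apply: formation_quasinilpotent => // {gT G} gT G FG.
  have [R [[_ [_ maxR]] [_ sRF]]] := radF _ G.
  exact: Phi_semisimple_Ftilde (subset_trans (maxR G (normal_refl G) FG) sRF).
have [R [[/normal_sub sRG [FR _]] [sFR _]]] := radF _ G.
rewrite qnilG in sFR.
suffices -> : G = R by [].
by apply/val_inj/eqP; rewrite eqEsubset sFR sRG.
Qed.
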